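(* Suppose there is a constant $C$ such that for every real non-trivial Dirichlet character $\chi$ there exists $r\in[1/2,1)$ with $$d_{r,\chi}^2<\frac{1}{2-2r}-\frac{C^2}{2(\log\operatorname{cond}(\chi))^2(1-r)^3}.$$ Then there is no Siegel zero for Dirichlet $L$-functions: for every such $\chi$, $L(\chi,\sigma)\neq0$ for all real $\sigma>1-C/\log\operatorname{cond}(\chi)$.
   Context: $\operatorname{cond}(\chi)$ is the conductor of $\chi$ and $L(\chi,s)=\sum_{n\ge1}\chi(n)n^{-s}$. For $1/2\le r<1$, $$d_{r,\chi}^2=\inf\int_0^1\Big|t^{1-r}-t^r\sum_{j=1}^{\ell}c_j\sum_{n<\alpha_j/t}\chi(n)\Big|^2\frac{dt}{t},$$ the infimum over all integers $\ell\ge0$, $c\in\mathbb{C}^\ell$, $\alpha\in(0,1]^\ell$. *)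

(* Defs.v *)
From mathcomp Require Import all_boot all_order all_algebra.
From mathcomp Require Import all_classical all_reals all_analysis.
From mathcomp Require Import complex.

Set Implicit Arguments.
Unset Strict Implicit.
Unset Printing Implicit Defensive.

Import Order.TTheory GRing.Theory Num.Theory numFieldNormedType.Exports.
Local Open Scope classical_set_scope.
Local Open Scope complex_scope.
Local Open Scope ring_scope.

(* Only the values at natural numbers are recorded; by periodicity they
   determine the character on all integers. *)
Record dirichlet_char (R : realType) := DirichletChar {
  modulus : nat;
  dchar_val :> nat -> R[i];
  modulus_gt0 : (0 < modulus)%N;
  dchar_periodic : forall n, dchar_val (n + modulus)%N = dchar_val n;
  dcharM : forall m n, dchar_val (m * n)%N = dchar_val m * dchar_val n;
  dchar_eq0 : forall n, dchar_val n = 0 <-> ~~ coprime n modulus }.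

Definition real_char (R : realType) (chi : dirichlet_char R) : Prop :=
  forall n, chi n \is Num.real.

Definition trivial_char (R : realType) (chi : dirichlet_char R) : Prop :=
  forall n, coprime n (modulus chi) -> chi n = 1.

Definition induced_from (R : realType) (chi : dirichlet_char R) (q : nat) : Prop :=
  (q %| modulus chi)%N /\
  exists2 psi : dirichlet_char R, modulus psi = q &
    forall n, coprime n (modulus chi) -> chi n = psi n.

Lemma induced_from_ex (R : realType) (chi : dirichlet_char R) :
  exists q, `[< induced_from chi q >].
Proof.
exists (modulus chi); apply/asboolP; split; first exact: dvdnn.
by exists chi.
Qed.

Definition conductor (R : realType) (chi : dirichlet_char R) : nat :=
  ex_minn (induced_from_ex chi).

(* Defined by the (ordered, possibly only conditionally convergent) series
   itself, at a real argument; for a nontrivial character it converges when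
   sigma > 0.  R[i]^o carries the topology of the complex modulus. *)
Definition dirichlet_L (R : realType) (chi : dirichlet_char R) (sigma : R) : R[i]^o :=
  lim ((fun N : nat =>
    \sum_(1 <= n < N.+1) chi n * (n%:R `^ (- sigma))%:C : R[i]^o) @ \oo).

(* The sum over the integers n with 1 <= n < x; truncn is the floor for x >= 0. *)
Definition char_sum (R : realType) (chi : dirichlet_char R) (x : R) : R[i] :=
  \sum_(1 <= n < (Num.truncn x).+1 | n%:R < x) chi n.

(* A Lebesgue integral against dt / t on (0, 1), with values in [0, +oo]. *)
Definition nb_integral (R : realType) (r : R) (chi : dirichlet_char R)
    (l : nat) (c : 'I_l -> R[i]) (alpha : 'I_l -> R) : \bar R :=
  (\int[lebesgue_measure]_(t in `]0%R, 1%R[)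
     (ComplexField.Normc.normc
        ((t `^ (1 - r))%:C -
         (t `^ r)%:C * \sum_(j < l) c j * char_sum chi (alpha j / t)) ^+ 2
      / t)%:E)%E.

Definition dist2 (R : realType) (r : R) (chi : dirichlet_char R) : \bar R :=
  ereal_inf [set x | exists (l : nat) (c : 'I_l -> R[i]) (alpha : 'I_l -> R),
    (forall j, 0 < alpha j <= 1) /\ x = nb_integral r chi c alpha].

(* Main.v *)
(* Suppose L(chi, s) = 0. If s > 1, sieving out the multiples of the primes
   p <= P multiplies the sum by the Euler factors 1 - chi(p) p^-s, so all the
   sieved sums vanish too, although they tend to 1 as P grows. If s <= 1, then
   s > r because the infimum is nonnegative, and t^(s-r) is orthogonal in
   L^2(]0,1[, dt/t) to every t^r S(alpha/t), S being the summatory function of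
   chi: the Mellin transform of S(alpha/t) at s is alpha^s L(chi, s) / s. Pairing
   t^(1-r) with t^(s-r) hence bounds the distance below by
   2 (s-r) / (1+s-2r)^2, which contradicts the hypothesis. *)
Require Import Defs.
From mathcomp Require Import all_boot all_order all_algebra.
From mathcomp Require Import all_classical all_reals all_analysis.
From mathcomp Require Import complex cyclic measurable_realfun ring lra.
Import Order.TTheory GRing.Theory Num.Theory numFieldNormedType.Exports.
Local Open Scope ring_scope.
Local Open Scope classical_set_scope.

(** * Integrals of real powers near 0 *)

(** For s < 1 the integrand blows up at 0, so the fundamental theorem of calculus is applied on
    closed intervals away from 0, and monotone convergence exhausts ]0, b]. *)
Lemma integral_powR (R : realType) (s b : R) : 0 < s -> 0 < b ->
  (\int[lebesgue_measure]_(t in `]0%R, b[) (t `^ (s - 1))%:E = (b `^ s / s)%:E)%E.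
Proof.
move=> s0 b0.
have mpow (D : set R) : measurable D ->
    measurable_fun D (EFin \o (fun t : R => t `^ (s - 1))).
  move=> _; apply/measurable_EFinP/measurable_funTS.
  exact: measurable_powR.
rewrite integral_itv_bndo_bndc; last exact: mpow.
(* Dividing by n + 2 rather than n + 1 keeps every interval nondegenerate, already at n = 0. *)
pose F (n : nat) : set R := `[b / n.+2%:R, b].
have bn0 n : 0 < b / n.+2%:R :> R by rewrite divr_gt0.
have bnb n : b / n.+2%:R < b :> R.
  by rewrite ltr_pdivrMr// ltr_pMr// ltr1n.
have -> : `]0, b] = \bigcup_n F n.
  apply/seteqP; split=> t /=; rewrite in_itv /=.
    move=> /andP[t0 tb]; exists (Num.truncn (b / t)) => //=.
    rewrite /F /= in_itv /= tb andbT ler_pdivrMr// mulrC -ler_pdivrMr//.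
    apply/ltW; apply: (lt_trans (truncnS_gt (b / t))).
    by rewrite ltr_nat.
  move=> [n _]; rewrite /F /= in_itv /= => /andP[t1 ->].
  by rewrite (lt_le_trans (bn0 n) t1).
have H : (\int[lebesgue_measure]_(x in F i) (x `^ (s - 1))%:E)%E @[i --> \oo]
    --> (\int[lebesgue_measure]_(x in \bigcup_i F i) (x `^ (s - 1))%:E)%E.
  apply: ge0_nondecreasing_set_cvg_integral.
  - move=> m n mn; rewrite subsetEset => t; rewrite /F /= !in_itv /= => /andP[h ->].
    rewrite andbT; apply: le_trans h.
    by rewrite ler_pM2l// lef_pV2 ?posrE// ler_nat !ltnS.
  - by move=> i; exact: measurable_itv.
  - by move=> i; apply: mpow; exact: measurable_itv.
  - by move=> i x _; rewrite lee_fin powR_ge0.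
have E n : (\int[lebesgue_measure]_(x in F n) (x `^ (s - 1))%:E)%E =
    (b `^ s / s - (b / n.+2%:R) `^ s / s)%:E.
  rewrite (@continuous_FTC2 _ _ (fun x => x `^ s / s)) ?EFinB//.
  - apply: derivable_within_continuous => x; rewrite in_itv /= => /andP[h _].
    by apply: derivable_powR; rewrite in_itv /= andbT (lt_le_trans (bn0 n) h).
  - have dF (x : R) : 0 < x -> derivable (fun x => x `^ s / s) x 1.
      move=> x0; apply: derivableM => //.
      by apply: derivable_powR; rewrite in_itv /= andbT.
    have cF (x : R) : 0 < x -> {for x, continuous (fun x => x `^ s / s)}.
      by move=> x0; apply: differentiable_continuous; exact/derivable1_diffP/dF.
    split.
    + by move=> x; rewrite in_itv /= => /andP[h _]; apply/dF/(lt_trans (bn0 n) h).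
    + by apply: cvg_at_right_filter; exact: cF.
    + by apply: cvg_at_left_filter; exact: cF.
  - move=> x; rewrite in_itv /= => /andP[h _].
    have x0 := lt_trans (bn0 n) h.
    have H1 := is_derive1_powR s x0.
    rewrite derive1E.
    have -> : (fun x => x `^ s / s) = s^-1 \*: (fun x => x `^ s).
      by apply/funext => y /=; rewrite mulrC.
    rewrite deriveZ /=; last exact: ex_derive.
    by rewrite derive_val /GRing.scale /= mulrA mulVf ?mul1r// gt_eqF.
have H2 : (\int[lebesgue_measure]_(x in F i) (x `^ (s - 1))%:E)%E @[i --> \oo]
    --> (b `^ s / s)%:E.
  under eq_cvg do rewrite E.
  apply: cvg_EFin; first exact: nearW.
  rewrite /comp /=.
  rewrite -[X in _ --> X]subr0 -[X in _ - X](mul0r s^-1).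
  apply: cvgB; first exact: cvg_cst.
  apply: cvgM; last exact: cvg_cst.
  have /cvg_at_rightP := powR_cvg0 s0; apply; split => //.
  rewrite -[X in _ --> X](mulr0 b); apply: cvgM; first exact: cvg_cst.
  have := @cvg_harmonic R; rewrite -cvg_shiftS; exact.
exact: cvg_unique H H2.
Qed.

Lemma integrable_powR (R : realType) (s b : R) : 0 < s -> 0 < b ->
  lebesgue_measure.-integrable `]0, b[ (fun t : R => (t `^ (s - 1))%:E).
Proof.
move=> s0 b0; apply/integrableP; split.
  by apply/measurable_EFinP/measurable_funTS; exact: measurable_powR.
under eq_integral do rewrite gee0_abs ?lee_fin ?powR_ge0//.
by rewrite integral_powR// ltry.
Qed.

(** * Boundedness of the partial sums of a nontrivial character *)

(** A full period contributes 0, so the partial sums started at 0 are themselves periodic and take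
    at most q values. The bound adds up their absolute values, plus one term for n = 0. *)
Lemma periodic_sum_bounded (R : realType) (X : nat -> R) (q : nat) :
  (0 < q)%N -> (forall n, X (n + q)%N = X n) -> \sum_(0 <= n < q) X n = 0 ->
  exists K, forall N, `|\sum_(1 <= n < N.+1) X n| <= K.
Proof.
move=> q0 Xq Sq.
pose S N := \sum_(0 <= n < N) X n.
have SD N : S (N + q)%N = S N.
  elim: N => [|N IH]; first by rewrite add0n /S Sq big_geq.
  by rewrite addSn /S !big_nat_recr//= -/(S _) -/(S _) IH Xq.
have SM m N : S (m * q + N)%N = S N.
  by elim: m => // m IH; rewrite mulSn -addnA addnC SD.
exists (\sum_(k < q) `|S k| + `|X 0%N|) => N.
have -> : \sum_(1 <= n < N.+1) X n = S N.+1 - X 0%N.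
  by rewrite /S [\sum_(0 <= n < N.+1) _]big_ltn// addrC addrA addNr add0r.
apply: (le_trans (ler_normB _ _)); rewrite lerD2r.
rewrite (divn_eq N.+1 q) SM.
rewrite (bigD1 (Ordinal (ltn_pmod N.+1 q0)))//= lerDl.
exact: sumr_ge0.
Qed.

(** Multiplication by [a] permutes the residues mod q, so the sum equals [X a] times itself, with
    [X a] different from 1. *)
Lemma nontrivial_sum_eq0 (R : realType) (X : nat -> R) (q a : nat) :
  (0 < q)%N -> (forall n, X (n + q)%N = X n) ->
  (forall m n, X (m * n)%N = X m * X n) -> coprime a q -> X a != 1 ->
  \sum_(0 <= n < q) X n = 0.
Proof.
move=> q0 Xq XM aq Xa.
have Xmod n : X (n %% q)%N = X n.
  rewrite [in RHS](divn_eq n q) addnC.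
  by elim: (n %/ q)%N => [|m IH]; rewrite ?mul0n ?addn0// mulSn addnCA addnC Xq.
rewrite big_mkord.
pose h (i : 'I_q) := Ordinal (ltn_pmod (a * i) q0).
have hinj : injective h.
  move=> i j; wlog ij : i j / (i <= j)%N.
    move=> W hij; case/orP: (leq_total i j) => le_ij; first exact: W.
    by apply/esym/W.
  move=> /(congr1 val) /= /esym/eqP; rewrite eqn_mod_dvd ?leq_mul2l ?ij ?orbT//.
  rewrite -mulnBr Gauss_dvdr 1?coprime_sym// -eqn_mod_dvd// !modn_small//.
  by move=> /eqP /val_inj.
have : \sum_(i < q) X i = X a * \sum_(i < q) X i.
  rewrite {1}(reindex_inj hinj) big_distrr /=.
  by apply: eq_bigr => i _; rewrite Xmod XM.
move/eqP; rewrite -subr_eq0 -{1}[\sum_(i < q) X i]mul1r -mulrBl mulf_eq0 subr_eq0.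
by rewrite eq_sym (negPf Xa) => /eqP.
Qed.

(** * Mellin transform of the summatory function *)

(** The cut-off N is independent of x: at x = alpha / t and N fixed, this is a finite sum of step
    functions of t, and the summatory function is recovered once N reaches the floor of x. *)
Definition sum_below {R : realType} (X : nat -> R) (N : nat) (x : R) : R :=
  \sum_(1 <= n < N.+1 | n%:R < x) X n.

Lemma sum_below_truncn (R : realType) (X : nat -> R) (N : nat) (x : R) :
  (Num.truncn x <= N)%N -> sum_below X N x = sum_below X (Num.truncn x) x.
Proof.
move=> xN; rewrite /sum_below (@big_cat_nat _ _ _ (Num.truncn x).+1)//=.
rewrite [X in _ + X]big_nat_cond [X in _ + X]big1 ?addr0// => n.
move=> /andP[/andP[h _] h2].
by have := lt_trans h2 (truncnS_gt x); rewrite ltr_nat ltnNge h.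
Qed.

(** The condition n < x only shortens the range, so the doubly truncated sum is again an ordinary
    partial sum. *)
Lemma sum_below_bounded (R : realType) (X : nat -> R) (K : R) (N : nat) (x : R) :
  (forall N, `|\sum_(1 <= n < N.+1) X n| <= K) -> `|sum_below X N x| <= K.
Proof.
move=> XK; elim: N => [|N IH].
  by rewrite /sum_below big_geq// normr0 (le_trans _ (XK 0%N)).
have [Nx|xN] := ltP N.+1%:R x; last first.
  by rewrite /sum_below big_mkcond big_nat_recr//= ltNge xN addr0 -big_mkcond.
rewrite /sum_below big_nat_cond (eq_bigl (fun n => (1 <= n < N.+2)%N && true)).
  by rewrite -big_nat_cond.
move=> n; rewrite andbT; apply/andb_idr => /andP[_ nN].
by apply: le_lt_trans Nx; rewrite ler_nat.
Qed.

(** The term n lives on ]0, alpha / n[, which lies inside ]0, 1[ because alpha <= 1, and contributes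
    X n (alpha / n)^s / s. *)
Lemma integral_sum_below (R : realType) (X : nat -> R) (s alpha : R) (N : nat) :
  0 < s -> 0 < alpha <= 1 ->
  (\int[lebesgue_measure]_(t in `]0%R, 1%R[)
     (sum_below X N (alpha / t) * t `^ (s - 1))%:E =
   (alpha `^ s / s * \sum_(1 <= n < N.+1) X n * n%:R `^ (- s))%:E)%E.
Proof.
move=> s0 /andP[a0 a1].
have mpow (D : set R) : measurable_fun D (EFin \o (fun t : R => t `^ (s - 1))).
  apply/measurable_EFinP/measurable_funTS.
  exact: measurable_powR.
have E (t : R) : t \in `]0, 1[%classic ->
  (sum_below X N (alpha / t) * t `^ (s - 1))%:E =
  (\sum_(i < N) (X i.+1)%:E *
     ((fun t : R => (t `^ (s - 1))%:E) \_ `]0%R, (alpha / i.+1%:R)%R[%classic) t)%E.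
  rewrite inE /= in_itv /= => /andP[t0 t1].
  rewrite /sum_below big_add1 /= big_mkord big_mkcond mulr_suml -sumEFin.
  apply: eq_bigr => i _; rewrite patchE.
  have -> : (t \in `]0, alpha / i.+1%:R[%classic) = (i.+1%:R < alpha / t).
    by apply/idP/idP; rewrite inE /= in_itv /= t0 /= ltr_pdivlMr// ltr_pdivlMr// mulrC.
  by case: ifP => _; rewrite ?mul0r ?mule0// EFinM.
etransitivity; first by apply: eq_integral => t; exact: E.
have mres (i : nat) : measurable_fun (`]0%R, 1%R[ : set R)
    ((EFin \o (fun t : R => t `^ (s - 1))) \_ `]0%R, (alpha / i.+1%:R)%R[%classic).
  apply: measurable_funTS.
  by apply/(measurable_restrictT _ _).1 => //; exact: mpow.
have int1 (i : nat) : lebesgue_measure.-integrable `]0%R, 1%R[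
    ((fun t : R => (t `^ (s - 1))%:E) \_ `]0%R, alpha / i.+1%:R[%classic).
  have Hi := integrable_powR R s 1 s0 ltr01.
  apply: (le_integrable _ _ _ Hi); first exact: measurable_itv.
  - exact: mres.
  - move=> t _; rewrite /patch; case: ifP => _ //.
    by rewrite abse0 abse_ge0.
rewrite integral_sum//; last by move=> i; apply: integrableZl.
rewrite big_add1 /= big_mkord big_distrr /= -sumEFin.
apply: eq_bigr => i _.
rewrite integralZl//.
rewrite -integral_mkcondr setIidr; last first.
  move=> t /=; rewrite !in_itv /= => /andP[-> h] /=; apply: (lt_le_trans h).
  rewrite ler_pdivrMr// mul1r; apply: (le_trans a1).
  by rewrite ler1n.
rewrite integral_powR ?divr_gt0// -EFinM; congr EFin.
rewrite powRM ?invr_ge0// ?ltW//.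
have -> : (i.+1%:R^-1 : R) `^ s = i.+1%:R `^ (- s).
  by rewrite -powR_inv1// -powRrM mulN1r.
by ring.
Qed.

(** Dominated convergence as N grows: K t^(s-1) dominates, and at each t the truncated sums are
    eventually constant. *)
Lemma mellin_sum_below (R : realType) (X : nat -> R) (K s alpha : R) :
  (forall N, `|\sum_(1 <= n < N.+1) X n| <= K) -> 0 < s -> 0 < alpha <= 1 ->
  lebesgue_measure.-integrable `]0%R, 1%R[
    (fun t : R => (sum_below X (Num.truncn (alpha / t)) (alpha / t) * t `^ (s - 1))%:E) /\
  (alpha `^ s / s * \sum_(1 <= n < N.+1) X n * n%:R `^ (- s))%:E @[N --> \oo] -->
  (\int[lebesgue_measure]_(t in `]0%R, 1%R[)
    (sum_below X (Num.truncn (alpha / t)) (alpha / t) * t `^ (s - 1))%:E)%E.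
Proof.
move=> XK s0 a01.
have mpow (D : set R) : measurable_fun D (fun t : R => t `^ (s - 1)).
  by apply/measurable_funTS; exact: measurable_powR.
(* For t > 0 the condition n < alpha / t reads n t < alpha, which is visibly measurable in t. *)
have msum_below N : measurable_fun (`]0%R, 1%R[ : set R)
    (fun t : R => sum_below X N (alpha / t)).
  apply: (eq_measurable_fun
    (fun t : R => \sum_(1 <= n < N.+1 | n%:R * t < alpha) X n)).
    move=> t; rewrite inE /= in_itv /= => /andP[t0 _].
    by rewrite /sum_below; apply: eq_bigl => n; rewrite ltr_pdivlMr.
  apply: measurable_funTS.
  under eq_fun do rewrite big_mkcond.
  apply: measurable_sum => n; apply: measurable_fun_ifT => //.
  by apply: measurable_fun_ltr => //; apply: measurable_funM.
have mf N : measurable_fun (`]0%R, 1%R[ : set R)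
    (EFin \o (fun t : R => sum_below X N (alpha / t) * t `^ (s - 1))).
  by apply/measurable_EFinP; apply: measurable_funM.
have cf (t : R) : `]0%R, 1%R[%classic t ->
   (sum_below X N (alpha / t) * t `^ (s - 1))%:E @[N --> \oo] -->
   (sum_below X (Num.truncn (alpha / t)) (alpha / t) * t `^ (s - 1))%:E.
  move=> _; apply: cvg_near_cst; exists (Num.truncn (alpha / t)) => // N /= h.
  by rewrite sum_below_truncn.
have mg : measurable_fun (`]0%R, 1%R[ : set R) (EFin \o
   (fun t : R => (sum_below X (Num.truncn (alpha / t)) (alpha / t) * t `^ (s - 1)))).
  exact: (emeasurable_fun_cvg _ _ mf cf).
have Ig : lebesgue_measure.-integrable `]0%R, 1%R[
    (fun t : R => (K%:E * (t `^ (s - 1))%:E)%E).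
  apply: integrableZl; first exact: measurable_itv.
  exact: integrable_powR.
have fg N (t : R) : `]0%R, 1%R[%classic t ->
   (`|(sum_below X N (alpha / t) * t `^ (s - 1))%:E| <= K%:E * (t `^ (s - 1))%:E)%E.
  move=> _; rewrite -EFinM lee_fin normrM (ger0_norm (powR_ge0 _ _)).
  by rewrite ler_wpM2r ?powR_ge0// sum_below_bounded.
set f := fun t : R => (sum_below X (Num.truncn (alpha / t)) (alpha / t) * t `^ (s - 1))%:E.
have [I1 _ H2] : [/\ lebesgue_measure.-integrable `]0%R, 1%R[ f,
    (\int[lebesgue_measure]_(t in `]0%R, 1%R[)
       `|(sum_below X N (alpha / t) * t `^ (s - 1))%:E - f t|)%E @[N --> \oo] --> 0%E &
    (\int[lebesgue_measure]_(t in `]0%R, 1%R[)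
       (sum_below X N (alpha / t) * t `^ (s - 1))%:E)%E @[N --> \oo] -->
    (\int[lebesgue_measure]_(t in `]0%R, 1%R[) f t)%E].
  apply: dominated_convergence Ig _.
  - exact: measurable_itv.
  - exact: mf.
  - exact: mg.
  - exact: aeW.
  - by apply: aeW => t N; exact: fg.
split => //.
by move: H2; under eq_cvg do rewrite integral_sum_below//.
Qed.

(* The convergence of the Dirichlet series comes for free from the dominated
   convergence of the integrals at alpha = 1. *)
Lemma mellin_char_sum (R : realType) (X : nat -> R) (K s : R) :
  (forall N, `|\sum_(1 <= n < N.+1) X n| <= K) -> 0 < s ->
  exists2 L : R, \sum_(1 <= n < N.+1) X n * n%:R `^ (- s) @[N --> \oo] --> L &
  forall alpha, 0 < alpha <= 1 ->
  lebesgue_measure.-integrable `]0%R, 1%R[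
    (fun t : R => (sum_below X (Num.truncn (alpha / t)) (alpha / t) * t `^ (s - 1))%:E) /\
  (\int[lebesgue_measure]_(t in `]0%R, 1%R[)
    (sum_below X (Num.truncn (alpha / t)) (alpha / t) * t `^ (s - 1))%:E)%E =
  (alpha `^ s / s * L)%:E.
Proof.
move=> XK s0.
have a1 : 0 < (1 : R) <= 1 by rewrite ltr01 lexx.
have [I1 C1] := mellin_sum_below R X K s 1 XK s0 a1.
pose L := s * fine (\int[lebesgue_measure]_(t in `]0%R, 1%R[)
    (sum_below X (Num.truncn (1 / t)) (1 / t) * t `^ (s - 1))%:E)%E.
have CL : \sum_(1 <= n < N.+1) X n * n%:R `^ (- s) @[N --> \oo] --> L.
  have fI := integrable_fin_num _ I1.
  move: C1; rewrite -(fineK (fI _)) => [/fine_cvg C1|]; last exact: measurable_itv.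
  rewrite (_ : (fun N => _) = (fun N => s *
      (1 `^ s / s * \sum_(1 <= n < N.+1) X n * n%:R `^ (- s)))).
    by apply: cvgM; [exact: cvg_cst|exact: C1].
  by apply/funext => N; rewrite powR1 mul1r mulrA divff ?mul1r// gt_eqF.
exists L => // alpha ha.
have [Ia Ca] := mellin_sum_below R X K s alpha XK s0 ha.
split => //.
apply/esym; apply: cvg_unique Ca => //.
apply: cvg_EFin; first exact: nearW.
by apply: cvgM; [exact: cvg_cst|exact: CL].
Qed.

(** * Nonvanishing to the right of 1, by sieving *)

(** The integers without prime factor up to P. The recursion on P matches the sieve, which removes
    at most one prime per step. *)
Fixpoint rough (P n : nat) : bool :=
  if P is k.+1 then rough k n && (prime k.+1 ==> ~~ (k.+1 %| n)%N) else true.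

Lemma rough_ndvd P n q : rough P n -> prime q -> (q <= P)%N -> ~~ (q %| n)%N.
Proof.
elim: P => [|P IH] /=; first by move=> _ q_pr; rewrite leqn0 => /eqP q0; rewrite q0 in q_pr.
move=> /andP[rP nd] q_pr; rewrite leq_eqVlt => /orP[/eqP qP|]; last exact: IH.
by rewrite -qP q_pr in nd.
Qed.

Lemma rough_gt P n : (1 < n)%N -> rough P n -> (P < n)%N.
Proof.
move=> n1 rn; rewrite ltnNge; apply/negP => nP.
have := rough_ndvd P n (pdiv n) rn (pdiv_prime n1).
by rewrite pdiv_dvd => /(_ (leq_trans (pdiv_leq (ltnW n1)) nP)).
Qed.

Lemma rough1 P : rough P 1.
Proof.
elim: P => //= P ->; apply/implyP => pr.
by rewrite dvdn1; case: P pr.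
Qed.

Lemma rough_mul P p m : prime p -> (P < p)%N -> rough P (p * m) = rough P m.
Proof.
move=> p_pr; elim: P => //= P IH Pp; rewrite IH ?(ltnW Pp)//.
have [q_pr|//] := boolP (prime P.+1).
rewrite Gauss_dvdr// prime_coprime// dvdn_prime2//.
by rewrite ltn_eqF.
Qed.

Lemma sum_multiples (R : realType) (F : nat -> R) (p N : nat) : (0 < p)%N ->
  \sum_(1 <= n < N.+1 | (p %| n)%N) F n =
  \sum_(1 <= m < (N %/ p).+1) F (p * m)%N.
Proof.
move=> p0; elim: N => [|N IH]; first by rewrite div0n !big_geq.
rewrite big_mkcond big_nat_recr//= -big_mkcond IH divnS//.
have [pN|pN] := boolP (p %| N.+1)%N; rewrite ?add0n ?addr0//.
rewrite add1n [RHS]big_nat_recr//=; congr (_ + F _).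
by have := divnS N p0; rewrite pN add1n => <-; rewrite mulnC divnK.
Qed.

(** The right side is the integral of x^(-1-e) over [n, n+1]. After division by (n+1)^(-e) the claim
    is 1 + e / (n+1) <= (n / (n+1))^(-e), which follows from exp x >= 1 + x and ln (1 + x) <= x. *)
Lemma zeta_term_le (R : realType) (e : R) (n : nat) : 0 < e -> (0 < n)%N ->
  n.+1%:R `^ (- (1 + e)) <= (n%:R `^ (- e) - n.+1%:R `^ (- e)) / e.
Proof.
move=> e0 n0.
have m0 : 0 < n%:R :> R by rewrite ltr0n.
have s0 : 0 < n.+1%:R :> R by rewrite ltr0n.
rewrite opprD powRD; last by rewrite pnatr_eq0/= implybT.
rewrite powR_inv1// ler_pdivlMr//.
have -> : n%:R `^ (- e) = n.+1%:R `^ (- e) * (n%:R / n.+1%:R) `^ (- e) :> R.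
  by rewrite -powRM// ?divr_ge0// mulrCA divff ?mulr1// gt_eqF.
have x0 : 0 < n%:R / n.+1%:R :> R by rewrite divr_gt0.
suff H : 1 + e / n.+1%:R <= (n%:R / n.+1%:R) `^ (- e) :> R.
  rewrite lerBrDl.
  have -> : n.+1%:R `^ (- e) + n.+1%:R^-1 * n.+1%:R `^ (- e) * e =
      n.+1%:R `^ (- e) * (1 + e / n.+1%:R) by ring.
  by rewrite ler_wpM2l// powR_ge0.
rewrite /powR gt_eqF//; apply: le_trans (expR_ge1Dx _).
rewrite lerD2l mulNr -mulrN ler_wpM2l// ?(ltW e0)// lerNr.
have -> : n%:R / n.+1%:R = 1 + - n.+1%:R^-1 :> R.
  by rewrite -(natr1 n); field; rewrite natr1 gt_eqF.
by apply: le_ln1Dx; rewrite ltrN2 invf_lt1// ltr1n ltnS.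
Qed.

(** The bounds of [zeta_term_le] telescope. The sum starts at 2 to match a sieved sum stripped of
    its term n = 1. *)
Lemma zeta_tail_le (R : realType) (e : R) (P k : nat) : 0 < e -> (0 < P)%N ->
  \sum_(2 <= n < (P + k).+1 | (P < n)%N) n%:R `^ (- (1 + e)) <=
  (P%:R `^ (- e) - (P + k)%:R `^ (- e)) / e.
Proof.
move=> e0 P0; elim: k => [|k IH].
  rewrite addn0 subrr mul0r big_nat_cond big1// => n /andP[/andP[_ h1] h2].
  by move: h1; rewrite ltnS leqNgt h2.
rewrite addnS big_mkcond big_nat_recr ?ltnS ?addn_gt0 ?P0//= -big_mkcond leq_addr.
have PK0 : (0 < P + k)%N by rewrite addn_gt0 P0.
have := lerD IH (zeta_term_le R e _ e0 PK0).
rewrite -mulrDl => /le_trans; apply.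
by rewrite subrKA.
Qed.

Lemma completely_multiplicative_sum_neq0 (R : realType) (X : nat -> R) (s : R) :
  (forall m n, X (m * n)%N = X m * X n) -> X 1%N = 1 -> (forall n, `|X n| <= 1) ->
  1 < s -> ~ \sum_(1 <= n < N.+1) X n * n%:R `^ (- s) @[N --> \oo] --> (0 : R).
Proof.
move=> XM X1 Xle s1 cv0.
pose h n := X n * n%:R `^ (- s).
have hM m n : h (m * n)%N = h m * h n.
  by rewrite /h XM natrM powRM// mulrACA.
pose T P N := \sum_(1 <= n < N.+1 | rough P n) h n.
(* Sieving by a prime p = P + 1 subtracts the terms n = p m; by multiplicativity these form [h p]
   times the previous sieved sum, cut at N / p. *)
have TS P N : T P.+1 N = T P N - (if prime P.+1 then h P.+1 * T P (N %/ P.+1)%N else 0).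
  have [p_pr|p_npr] := boolP (prime P.+1); last first.
    rewrite subr0 /T; apply: eq_bigl => n /=.
    by rewrite (negPf p_npr) /= andbT.
  apply/eqP; rewrite eq_sym subr_eq; apply/eqP.
  rewrite /T (bigID (fun n => (P.+1 %| n)%N)) /= addrC p_pr /=; congr (_ + _).
  rewrite big_mkcondl sum_multiples// -big_mkcondr big_distrr /= big_mkcond [RHS]big_mkcond.
  by apply: eq_bigr => m _; rewrite rough_mul// hM.
(* The limit 0 survives each sieving step, since N / p tends to infinity with N. *)
have T0 P : T P N @[N --> \oo] --> (0 : R).
  elim: P => [|P IH]; first exact: cv0.
  have IHd : T P (N %/ P.+1)%N @[N --> \oo] --> (0 : R).
    apply: (@cvg_comp _ _ _ (fun N => (N %/ P.+1)%N) (T P) _ \oo); last exact: IH.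
    apply/cvgnyPge => A; near=> N; rewrite leq_divRL//.
    by near: N; exact: nbhs_infty_ge.
  have -> : (0 : R) = 0 - (if prime P.+1 then h P.+1 * 0 else 0).
    by rewrite mulr0 if_same subr0.
  under eq_cvg do rewrite TS.
  apply: cvgB => //; case: ifP => _; last exact: cvg_cst.
  by apply: cvgM => //; exact: cvg_cst.
pose e := s - 1; have e0 : 0 < e by rewrite subr_gt0.
have [P P0 Ple] : exists2 P, (0 < P)%N & P%:R `^ (- e) / e <= 1 / 2.
  (* The requirement amounts to P^e >= 2 / e. *)
  exists (Num.truncn ((2 / e) `^ e^-1)).+1 => //.
  set P := (_.+1)%:R : R.
  have : (2 / e) `^ e^-1 <= P by exact/ltW/truncnS_gt.
  move=> /(ge0_ler_powR (ltW e0)); rewrite !nnegrE powR_ge0 ler0n => /(_ isT isT).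
  rewrite -powRrM mulVf ?gt_eqF// powRr1 ?divr_ge0// ?(ltW e0)// => H.
  rewrite powRN ler_pdivrMr// mul1r -[leRHS]invrK lef_pV2 ?posrE ?invr_gt0 ?mulr_gt0 ?powR_gt0//.
  by rewrite invfM invrK.
(* Besides n = 1, only integers n > P survive the sieve, so the rest is bounded by the zeta tail. *)
have TP k : `|T P (P + k)%N - 1| <= 1 / 2.
  rewrite /T big_ltn_cond ?ltnS ?addn_gt0 ?P0// rough1 {1}/h X1 powR1 mul1r addrC addKr.
  apply: (le_trans (ler_norm_sum _ _ _)).
  apply: (@le_trans _ _ (\sum_(2 <= n < (P + k).+1 | (P < n)%N) n%:R `^ (- (1 + e)))).
    rewrite big_mkcond [leRHS]big_mkcond /=; rewrite big_nat_cond [leRHS]big_nat_cond.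
    apply: ler_sum => n /andP[/andP[n2 _] _].
    have [rn|_] := ifP (rough P n); last by case: ifP => // _; exact: powR_ge0.
    rewrite rough_gt// /h normrM (ger0_norm (powR_ge0 _ _)).
    by rewrite addrC subrK ler_piMl ?powR_ge0.
  apply: (le_trans (zeta_tail_le _ _ _ _ e0 P0)); apply: le_trans Ple.
  by rewrite ler_pM2r ?invr_gt0// gerBl powR_ge0.
(* For large N the sieved sum would be strictly within 1/2 of 0, yet within 1/2 of 1. *)
have /cvgrPdist_lt /(_ (1 / 2)) := T0 P.
rewrite divr_gt0// => /(_ isT) [k _ Hk].
have := Hk (P + k)%N (leq_addl _ _); have := TP k.
rewrite /= sub0r normrN => H1 H2.
have := ler_normB (T P (P + k)%N) (T P (P + k)%N - 1).
by rewrite opprB addrC subrK normr1 leNgt (lt_le_trans (ltr_leD H2 H1))// -mulrDl; lra.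
Unshelve. all: by end_near. Qed.

(** * Monotonicity of the integral, and passage from real to complex limits *)

(** The integral of f is at most that of its positive part, and any simple function below that part
    lies below g. Hence the integrand of [nb_integral] enters later only through pointwise
    bounds. *)
Lemma le_integral_ge0r (d : measure_display) (T : measurableType d) (R : realType)
  (mu : {measure set T -> \bar R}) (D : set T) (f g : T -> \bar R) :
  (forall x, D x -> 0 <= g x)%E -> (forall x, D x -> f x <= g x)%E ->
  (\int[mu]_(x in D) f x <= \int[mu]_(x in D) g x)%E.
Proof.
move=> g0 fg; rewrite integralE.
apply: (@le_trans _ _ (\int[mu]_(x in D) (f^\+ x))%E).
  by rewrite geeDl// oppe_le0 integral_ge0.
rewrite !ge0_integralE//; apply: ereal_sup_le => _ [h /= hf <-]; exists h => //= x.
apply: (le_trans (hf x)); rewrite /patch; case: ifPn => // xD.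
by rewrite funeposE ge_max fg ?g0//; exact: set_mem.
Qed.

Lemma cvg_real_complex (R : realType) (u : nat -> R) (l : R) :
  u n @[n --> \oo] --> l ->
  ((u n)%:C%C : R[i]^o) @[n --> \oo] --> (l%:C%C : R[i]^o).
Proof.
move=> /cvgrPdist_lt ul; apply/cvgrPdist_lt => -[e e'].
(* In the order on R[i], a positive number has imaginary part 0. *)
rewrite ltcE /= => /andP[/eqP -> e0].
near=> n; rewrite -rmorphB /= normc_def /= expr0n/= addr0 sqrtr_sqr ltcR.
by near: n; exact: ul.
Unshelve. all: by end_near. Qed.

(** * Real characters as real-valued functions *)

Definition re_char {R : realType} (chi : dirichlet_char R) (n : nat) : R := complex.Re (chi n).

Lemma re_charE (R : realType) (chi : dirichlet_char R) (chi_real : real_char chi) n :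
  chi n = (re_char chi n)%:C%C.
Proof. by rewrite RRe_real. Qed.

Lemma re_char_periodic (R : realType) (chi : dirichlet_char R) n :
  re_char chi (n + modulus chi)%N = re_char chi n.
Proof. by rewrite /re_char dchar_periodic. Qed.

Lemma re_charM (R : realType) (chi : dirichlet_char R) (chi_real : real_char chi) m n :
  re_char chi (m * n)%N = re_char chi m * re_char chi n.
Proof. apply: complexI; rewrite -(re_charE R chi chi_real) dcharM.
by rewrite !(re_charE R chi chi_real) -rmorphM.
Qed.

Lemma re_char_eq0 (R : realType) (chi : dirichlet_char R) (chi_real : real_char chi) n :
  (re_char chi n == 0) = ~~ coprime n (modulus chi).
Proof.
apply/eqP/idP => [h|/dchar_eq0 h]; first by apply/dchar_eq0; rewrite (re_charE R chi chi_real) h.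
by rewrite /re_char h.
Qed.

Lemma re_char1 (R : realType) (chi : dirichlet_char R) (chi_real : real_char chi) :
  re_char chi 1%N = 1.
Proof.
have : re_char chi 1%N != 0 by rewrite (re_char_eq0 R chi chi_real) coprime1n.
by move=> n0; apply: (mulfI n0); rewrite -(re_charM R chi chi_real) mulr1.
Qed.

(** By Euler's theorem a value at an n coprime to the modulus is a root of unity, hence of absolute
    value 1; the other values are 0. *)
Lemma re_char_le1 (R : realType) (chi : dirichlet_char R) (chi_real : real_char chi) n :
  `|re_char chi n| <= 1.
Proof.
have [nq|nq] := boolP (coprime n (modulus chi)); last first.
  by rewrite -(re_char_eq0 R chi chi_real) in nq; rewrite (eqP nq) normr0 ler01.
have XX k : re_char chi (n ^ k)%N = re_char chi n ^+ k.
  by elim: k => [|k IH]; rewrite ?(re_char1 R chi chi_real)// expnS (re_charM R chi chi_real) IH exprS.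
have Xmod m : re_char chi (m %% modulus chi)%N = re_char chi m.
  rewrite [in RHS](divn_eq m (modulus chi)) addnC.
  elim: (m %/ modulus chi)%N => [|k IH]; first by rewrite mul0n addn0.
  by rewrite mulSn addnCA addnC re_char_periodic.
have := XX (totient (modulus chi)).
rewrite -Xmod Euler_exp_totient// Xmod (re_char1 R chi chi_real) => /esym /(congr1 Num.norm).
rewrite normrX normr1 => /eqP.
rewrite pexpr_eq1 ?totient_gt0 ?modulus_gt0// => /eqP ->.
exact: lexx.
Qed.

Lemma re_char_sum_bounded (R : realType) (chi : dirichlet_char R) (chi_real : real_char chi) :
  ~ trivial_char chi ->
  exists K, forall N, `|\sum_(1 <= n < N.+1) re_char chi n| <= K.
Proof.
move=> /existsNP[a /not_implyP[aq chia]].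
apply: (periodic_sum_bounded R _ _ (modulus_gt0 chi) (re_char_periodic R chi)).
apply: (nontrivial_sum_eq0 R _ _ a (modulus_gt0 chi) (re_char_periodic R chi) (re_charM R chi chi_real) aq).
by apply/eqP => h; apply: chia; rewrite (re_charE R chi chi_real) h.
Qed.

Lemma char_sumE (R : realType) (chi : dirichlet_char R) (chi_real : real_char chi) x :
  char_sum chi x = (sum_below (re_char chi) (Num.truncn x) x)%:C%C.
Proof.
by rewrite /char_sum /sum_below rmorph_sum; apply: eq_bigr => n _; rewrite (re_charE R chi chi_real).
Qed.

Lemma dirichlet_LE (R : realType) (chi : dirichlet_char R) (chi_real : real_char chi) s (L : R) :
  \sum_(1 <= n < N.+1) re_char chi n * n%:R `^ (- s) @[N --> \oo] --> L ->
  dirichlet_L chi s = L%:C%C.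
Proof.
move=> /cvg_real_complex cL; apply: cvg_lim => //.
rewrite (_ : (fun N => _) = fun N =>
  ((\sum_(1 <= n < N.+1) re_char chi n * n%:R `^ (- s))%:C%C : R[i]^o)) //.
apply/funext => N; rewrite rmorph_sum; apply: eq_bigr => n _.
by rewrite (re_charE R chi chi_real) -rmorphM.
Qed.

(** * Lower bound for the distance at a zero *)

(** As the powers of t and the character sums are real, this allows each coefficient [c j] to be
    replaced by its real part. *)
Lemma sqr_Re_le_normc (R : realType) (z : R[i]) :
  complex.Re z ^+ 2 <= ComplexField.Normc.normc z ^+ 2.
Proof.
by case: z => a b /=; rewrite sqr_sqrtr ?addr_ge0 ?sqr_ge0// lerDl sqr_ge0.
Qed.

(* With F := t^(1-r) - t^r S and g := t^(s-r), this is F^2 >= 2 lambda g F -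
   lambda^2 g^2 divided by t; integrating it replaces Cauchy-Schwarz, without
   assuming that F is square integrable. *)
Lemma powR_tangent (R : realType) (r s lambda t S : R) : 0 < t ->
  2 * lambda * t `^ ((1 + s - 2 * r) - 1) - 2 * lambda * (S * t `^ (s - 1)) -
    lambda ^+ 2 * t `^ (2 * (s - r) - 1) <=
  (t `^ (1 - r) - t `^ r * S) ^+ 2 / t.
Proof.
move=> t0; have tn0 : t != 0 by rewrite gt_eqF.
have U0 : t `^ r != 0 by rewrite gt_eqF// powR_gt0.
have tB (x y : R) : t `^ (x - y) = t `^ x / t `^ y by rewrite powRB// tn0 implybT.
have tD (x y : R) : t `^ (x + y) = t `^ x * t `^ y by rewrite powRD// tn0 implybT.
have -> : 1 + s - 2 * r - 1 = s - r - r by ring.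
have -> : 2 * (s - r) - 1 = (s - r) + (s - r) - 1 by ring.
rewrite (tB (s - r) r) (tB _ 1) (tB _ 1) (tD (s - r)) (tB s r) (tB 1 r) powRr1 ?(ltW t0)//.
set T := t `^ s; set U := t `^ r.
rewrite -subr_ge0.
have -> : (t / U - U * S) ^+ 2 / t - (2 * lambda * (T / U / U) -
    2 * lambda * (S * (T / t)) - lambda ^+ 2 * (T / U * (T / U) / t)) =
  (t / U - U * S - lambda * (T / U)) ^+ 2 / t by field; rewrite tn0 U0.
by rewrite divr_ge0 ?sqr_ge0// ltW.
Qed.

(** The bound is d / b^2 with b = 1 + s - 2r and d = 2(s - r). In L^2(]0,1[, dt/t), 1/b is the inner
    product of t^(1-r) and t^(s-r), and 1/d the squared norm of t^(s-r), so this is the squared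
    length of the projection of t^(1-r) onto t^(s-r). It is obtained by integrating
    [powR_tangent]. *)
Lemma nb_integral_ge (R : realType) (chi : dirichlet_char R) (r s : R)
    (l : nat) (c : 'I_l -> R[i]) (alpha : 'I_l -> R) :
  real_char chi -> ~ trivial_char chi -> r < 1 -> r < s -> 0 < s ->
  dirichlet_L chi s = 0 -> (forall j, 0 < alpha j <= 1) ->
  ((2 * (s - r) / (1 + s - 2 * r) ^+ 2)%:E <= nb_integral r chi c alpha)%E.
Proof.
move=> chi_real chi_nt r1 rs s0 L0 ha.
have [K XK] := re_char_sum_bounded R chi chi_real chi_nt.
have [L cL mL] := mellin_char_sum R (re_char chi) K s XK s0.
have {cL L0}L0 : L = 0.
  by apply: complexI; rewrite -(dirichlet_LE R chi chi_real s L cL).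
have b0 : 0 < 1 + s - 2 * r by lra.
have d0 : 0 < 2 * (s - r) by lra.
set b := 1 + s - 2 * r in b0 *; set d := 2 * (s - r) in d0 *.
(* The maximizer of the bound [2 lambda / b - lambda^2 / d]. *)
pose lambda := d / b.
pose S j (t : R) := sum_below (re_char chi) (Num.truncn (alpha j / t)) (alpha j / t).
pose A j := complex.Re (c j).
pose f1 (t : R) : \bar R := ((2 * lambda)%:E * (t `^ (b - 1))%:E)%E.
pose f2 (t : R) : \bar R :=
  (\sum_(j < l) (2 * lambda * A j)%:E * (S j t * t `^ (s - 1))%:E)%E.
pose f3 (t : R) : \bar R := ((lambda ^+ 2)%:E * (t `^ (d - 1))%:E)%E.
have i1 : lebesgue_measure.-integrable `]0%R, 1%R[ f1.
  apply: integrableZl; first exact: measurable_itv.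
  exact: integrable_powR.
have i3 : lebesgue_measure.-integrable `]0%R, 1%R[ f3.
  apply: integrableZl; first exact: measurable_itv.
  exact: integrable_powR.
have i2' j : lebesgue_measure.-integrable `]0%R, 1%R[
    (fun t : R => ((2 * lambda * A j)%:E * (S j t * t `^ (s - 1))%:E)%E).
  apply: integrableZl; first exact: measurable_itv.
  by have [] := mL (alpha j) (ha j).
have i2 : lebesgue_measure.-integrable `]0%R, 1%R[ f2.
  by apply: integrable_sum; [exact: measurable_itv|move=> j _; exact: i2'].
have i12 : lebesgue_measure.-integrable `]0%R, 1%R[ (f1 \- f2)%E.
  by apply: integrableB => //; exact: measurable_itv.
have I1 : (\int[lebesgue_measure]_(t in `]0%R, 1%R[) f1 t = (2 * lambda / b)%:E)%E.
  rewrite integralZl//; last exact: integrable_powR.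
  by rewrite integral_powR// powR1 -EFinM mul1r.
have I3 : (\int[lebesgue_measure]_(t in `]0%R, 1%R[) f3 t = (lambda ^+ 2 / d)%:E)%E.
  rewrite integralZl//; last exact: integrable_powR.
  by rewrite integral_powR// powR1 -EFinM mul1r.
(* Orthogonality: each summand integrates to a multiple of L(chi, s) = 0, whatever the coefficients
   are. *)
have I2 : (\int[lebesgue_measure]_(t in `]0%R, 1%R[) f2 t = 0)%E.
  rewrite integral_sum//; apply: big1 => j _.
  have [ij Ij] := mL (alpha j) (ha j).
  by rewrite integralZl// Ij L0 mulr0 mule0.
have Ih : (\int[lebesgue_measure]_(t in `]0%R, 1%R[) ((f1 \- f2) \- f3) t =
    (d / b ^+ 2)%:E)%E.
  rewrite integralB//; rewrite integralB// I1 I2 I3 sube0 -EFinB; congr EFin.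
  by rewrite /lambda; field; rewrite !gt_eqF.
rewrite -Ih; apply: le_integral_ge0r => t /=; rewrite in_itv /= => /andP[t0 _].
  by rewrite lee_fin divr_ge0 ?sqr_ge0// ltW.
rewrite /f1 /f2 /f3 -!EFinM.
have -> : (\sum_(j < l) (2 * lambda * A j)%:E * (S j t * t `^ (s - 1))%:E)%E =
    (2 * lambda * ((\sum_(j < l) A j * S j t) * t `^ (s - 1)))%:E.
  rewrite mulr_suml mulr_sumr -sumEFin; apply: eq_bigr => j _.
  by rewrite -EFinM; congr EFin; ring.
rewrite -!EFinB lee_fin.
apply: le_trans (powR_tangent R r s lambda t (\sum_(j < l) A j * S j t) t0) _.
rewrite ler_pM2r ?invr_gt0//.
set z := (X in ComplexField.Normc.normc X).
suff -> : t `^ (1 - r) - t `^ r * (\sum_(j < l) A j * S j t) = complex.Re z.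
  exact: sqr_Re_le_normc.
have ReM (k : R) (w : R[i]) : complex.Re (k%:C%C * w) = k * complex.Re w.
  by case: w => x y /=; rewrite mul0r subr0.
have ReB (w w' : R[i]) : complex.Re (w - w') = complex.Re w - complex.Re w'.
  by case: w; case: w'.
have ReD : {morph (@complex.Re R) : w w' / w + w'} by case=> ? ? [].
rewrite /z ReB ReM /=; congr (_ - _ * _).
rewrite (big_morph _ ReD (erefl _)); apply: eq_bigr => j _.
by rewrite (char_sumE R chi chi_real) [c j * _]mulrC ReM mulrC.
Qed.

(** * Comparison with the hypothesis on the distance *)

(** To be read with a = 1 - r and delta = 1 - sigma: the assumed upper bound on the left, the
    projection bound on the right. The latter equals 1/(2a) - delta^2 / (2a (2a - delta)^2), and
    delta < D while 2a - delta >= a. *)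
Lemma distance_gap (R : realFieldType) (a D delta : R) : 0 <= delta -> delta < D -> D < a ->
  1 / (2 * a) - D ^+ 2 / (2 * a ^+ 3) <= 2 * (a - delta) / (2 * a - delta) ^+ 2.
Proof.
move=> d0 dD Da.
have a0 : 0 < a by lra.
have b0 : 0 < 2 * a - delta by lra.
have -> : 2 * (a - delta) / (2 * a - delta) ^+ 2 =
    1 / (2 * a) - delta ^+ 2 / (2 * a * (2 * a - delta) ^+ 2).
  by field; rewrite !gt_eqF.
rewrite lerD2l lerN2.
have -> : D ^+ 2 / (2 * a ^+ 3) = D ^+ 2 / (2 * a * a ^+ 2).
  by congr (_ / _); ring.
have H : a ^+ 2 <= (2 * a - delta) ^+ 2 by rewrite ler_pXn2r ?nnegrE//; lra.
have H2 : delta ^+ 2 <= D ^+ 2 by rewrite ler_pXn2r ?nnegrE//; lra.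
apply: ler_pM => //; first exact: sqr_ge0.
  by rewrite invr_ge0 !mulr_ge0 ?sqr_ge0// ltW.
by rewrite lef_pV2 ?posrE ?mulr_gt0 ?exprn_gt0// ler_pM2l ?mulr_gt0.
Qed.

Theorem theorem9 (R : realType) (C : R)
  (hC : forall chi : dirichlet_char R, real_char chi -> ~ trivial_char chi ->
     exists2 r : R, 1 / 2 <= r < 1 &
       (dist2 r chi <
        (1 / (2 - 2 * r)
         - C ^+ 2 / (2 * ln (conductor chi)%:R ^+ 2 * (1 - r) ^+ 3))%:E)%E) :
  forall chi : dirichlet_char R, real_char chi -> ~ trivial_char chi ->
    forall sigma : R, 1 - C / ln (conductor chi)%:R < sigma ->
      dirichlet_L chi sigma <> 0.
Proof.
move=> chi chi_real chi_nt sigma hsigma L0.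
have [s1|s1] := ltP 1 sigma.
  have [K XK] := re_char_sum_bounded R chi chi_real chi_nt.
  have [L cL _] := mellin_char_sum R (re_char chi) K sigma XK (lt_trans ltr01 s1).
  apply: (completely_multiplicative_sum_neq0 R (re_char chi) sigma
    (re_charM R chi chi_real) (re_char1 R chi chi_real) (re_char_le1 R chi chi_real) s1).
  have L00 : L = 0.
    by apply: complexI; rewrite -(dirichlet_LE R chi chi_real sigma L cL).
  by rewrite L00 in cL; exact: cL.
have [r /andP[r2 r1]] := hC chi chi_real chi_nt.
set D := C / ln (conductor chi)%:R in hsigma.
(* Distributing inverses is valid even at a zero logarithm, the inverse of 0 being 0. *)
have -> : C ^+ 2 / (2 * ln (conductor chi)%:R ^+ 2 * (1 - r) ^+ 3) =
    D ^+ 2 / (2 * (1 - r) ^+ 3).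
  by rewrite /D expr_div_n; rewrite !invfM; ring.
move=> /ereal_inf_lt[_ [l [c [alpha [ha ->]]]] hlt].
have a0 : 0 < 1 - r by rewrite subr_gt0.
(* The assumed bound exceeds a nonnegative integral, so D^2 < (1 - r)^2; this is what places sigma >
   1 - D to the right of r. *)
have Da : D < 1 - r.
  have : (0%:E <= nb_integral r chi c alpha)%E.
    apply: integral_ge0 => t /=; rewrite in_itv /= => /andP[t0 _].
    by rewrite lee_fin divr_ge0 ?sqr_ge0// ltW.
  move=> /le_lt_trans /(_ hlt); rewrite lte_fin.
  have -> : 1 / (2 - 2 * r) - D ^+ 2 / (2 * (1 - r) ^+ 3) =
      ((1 - r) ^+ 2 - D ^+ 2) / (2 * (1 - r) ^+ 3).
    have a20 : 0 < 2 - 2 * r by lra.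
    by field; rewrite !gt_eqF.
  rewrite pmulr_lgt0 ?invr_gt0 ?mulr_gt0 ?exprn_gt0// subr_gt0.
  (* Squares can be compared because 1 - D < sigma <= 1 forces D > 0. *)
  by rewrite ltr_pXn2r ?nnegrE//; lra.
have rs : r < sigma by lra.
have := nb_integral_ge R chi r sigma l c alpha chi_real chi_nt r1 rs _ L0 ha.
move=> /(_ ltac:(lra)) /le_lt_trans /(_ hlt); rewrite lte_fin.
have d0 : 0 <= 1 - sigma by lra.
have dD : 1 - sigma < D by lra.
have := distance_gap R (1 - r) D (1 - sigma) d0 dD Da.
have -> : 2 * (1 - r) = 2 - 2 * r by ring.
have -> : 1 - r - (1 - sigma) = sigma - r by ring.
have -> : 2 - 2 * r - (1 - sigma) = 1 + sigma - 2 * r by ring.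
by move=> h1 h2; have := le_lt_trans h1 h2; rewrite ltxx.
Qed.
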